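(* Let $\Gamma$ be a strongly connected graph with nonnegative weights and at least two vertices. Then $$\min_{i\neq 0}\lambda_i(\Delta(\widetilde{\Gamma}))\leq \min_{i\neq 0}\Re(\lambda_i(\Delta(\Gamma)))\leq \max_i\Re(\lambda_i(\Delta(\Gamma)))\leq \max_i\lambda_i(\Delta(\widetilde{\Gamma})).$$
   Context: A graph $\Gamma=(V,E,w)$ is a finite weighted directed graph, loops allowed, without multiple edges; $w_{ij}$ is the weight of the directed edge from $j$ to $i$, with $w_{ij}=0$ if and only if there is no such edge. $\Gamma$ is strongly connected if any two distinct vertices are joined by directed paths in both directions. $d_i^{\mathrm{in}}=\sum_j w_{ij}$. The normalized Laplace operator on complex valued functions on $V$ is $\Delta v(i)=v(i)-\frac{1}{d_i^{\mathrm{in}}}\sum_j w_{ij}v(j)$ if $d_i^{\mathrm{in}}\neq 0$ and $\Delta v(i)=0$ otherwise. Its eigenvalues (with algebraic multiplicity) are $\lambda_0,\dots,\lambda_{n-1}$, $n=|V|$, where $\lambda_0=0$ is the eigenvalue corresponding to the constant function. For $\Gamma$ strongly connected with nonnegative weights (and all in-degrees nonzero) let $\phi:V\to(0,\infty)$ be the Perron vector, i.e. a positive function (existing by the Perron–Frobenius theorem) with $\sum_j\frac{w_{ji}}{d_j^{\mathrm{in}}}\phi(j)=\phi(i)$ for all $i\in V$. The graph $\widetilde\Gamma$ is the undirected graph on $V$ with nonnegative symmetric weights $\widetilde w_{ij}=\frac{w_{ij}}{d_i^{\mathrm{in}}}\phi(i)+\frac{w_{ji}}{d_j^{\mathrm{in}}}\phi(j)$,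 $i,j\in V$; $\Delta(\widetilde\Gamma)$ is its normalized Laplace operator (with degrees $\widetilde d_i=\sum_j\widetilde w_{ij}$). *)

(* Defs.v *)
From mathcomp Require Import all_boot all_order all_algebra.
From mathcomp Require Import reals.
From mathcomp Require Export complex.

Set Implicit Arguments.
Unset Strict Implicit.
Unset Printing Implicit Defensive.

Import Order.TTheory GRing.Theory Num.Theory.
Local Open Scope ring_scope.
Local Open Scope complex_scope.

(* A weighted digraph on V = 'I_n is its weight matrix w : 'M[R]_n, where
   w i j is the weight of the edge from j to i, and w i j = 0 encodes the
   absence of that edge. *)

Section Graph.
Variables (R : realType) (n : nat).
Implicit Types (w : 'M[R]_n) (phi : 'I_n -> R).

Definition edge w : rel 'I_n := fun j i => w i j != 0.

Definition strongly_connected w : Prop :=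
  forall i j : 'I_n, i != j -> connect (edge w) i j /\ connect (edge w) j i.

Definition indeg w (i : 'I_n) : R := \sum_j w i j.

Definition laplace w (v : 'I_n -> R[i]) (i : 'I_n) : R[i] :=
  if indeg w i != 0 then
    v i - (indeg w i)%:C^-1 * \sum_j (w i j)%:C * v j
  else 0.

(* Column j is the image under laplace of the j-th basis function. *)
Definition laplace_mx w : 'M[R[i]]_n :=
  \matrix_(i, j) laplace w (fun k => (k == j)%:R) i.

Definition is_perron w phi : Prop :=
  (forall i, 0 < phi i) /\
  (forall i, \sum_j w j i / indeg w j * phi j = phi i).

Definition tilde_graph w phi : 'M[R]_n :=
  \matrix_(i, j) (w i j / indeg w i * phi i + w j i / indeg w j * phi j).

(* The n roots in C of the characteristic polynomial, each repeated according
   to its multiplicity (see prod_spectrum). *)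
Definition spectrum (A : 'M[R[i]]_n) : seq R[i] :=
  sval (closed_field_poly_normal (char_poly A)).

Definition eigenvalues w : seq R[i] := spectrum (laplace_mx w).

(* lambda_i for i != 0: exactly one copy of the eigenvalue 0, which belongs to
   the constant functions, is removed. *)
Definition nonzeroth_eigenvalues w : seq R[i] := rem 0 (eigenvalues w).

End Graph.

(* The neutral element of the iteration is itself an element of s, so these
   are the least and the greatest element of s whenever s is nonempty. *)
Definition min_seq (R : realType) (s : seq R) : R :=
  \big[Num.min/head 0 s]_(x <- s) x.

Definition max_seq (R : realType) (s : seq R) : R :=
  \big[Num.max/head 0 s]_(x <- s) x.

Section SpectrumTheory.
Variables (R : realType) (n : nat).
Implicit Types (w : 'M[R]_n) (A : 'M[R[i]]_n).

Lemma laplace_mxE w (v : 'I_n -> R[i]) :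
  laplace_mx w *m (\col_i v i) = \col_i laplace w v i.
Proof.
apply/matrixP => i j; rewrite !mxE /laplace.
under eq_bigr => k _ do rewrite !mxE /laplace.
case: ifP => _; last by rewrite big1 // => k _; rewrite mul0r.
under eq_bigr => k _ do rewrite mulrBl.
rewrite big_split /= sumrN; congr (_ - _).
  rewrite (bigD1 i) //= eqxx mul1r big1 ?addr0 // => k ki.
  by rewrite eq_sym (negbTE ki) mul0r.
rewrite mulr_sumr; apply: eq_bigr => k _; rewrite -mulrA; congr (_ * _).
rewrite (bigD1 k) //= eqxx mulr1 big1 ?addr0 // => l lk.
by rewrite (negbTE lk) mulr0.
Qed.

Lemma prod_spectrum A : char_poly A = \prod_(z <- spectrum A) ('X - z%:P).
Proof.
rewrite /spectrum; case: closed_field_poly_normal => r /= ->.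
by rewrite (monicP (char_poly_monic A)) scale1r.
Qed.

Lemma size_spectrum A : size (spectrum A) = n.
Proof.
have := size_char_poly A.
by rewrite prod_spectrum size_prod_XsubC => -[].
Qed.

Lemma mem_spectrumP A z :
  reflect (exists2 v : 'cV[R[i]]_n, v != 0 & A *m v = z *: v)
          (z \in spectrum A).
Proof.
have trA : char_poly A^T = char_poly A.
  rewrite /char_poly -[in RHS]det_tr; congr (\det _).
  by rewrite /char_poly_mx raddfB /= tr_scalar_mx map_trmx.
rewrite -root_prod_XsubC -prod_spectrum -trA -eigenvalue_root_char.
apply: (iffP eigenvalueP) => -[v] h1 h2; exists v^T.
- by rewrite trmx_eq0.
- by rewrite -[A]trmxK -trmx_mul h1 linearZ.
- by rewrite -trmx_mul h2 linearZ.
- by rewrite trmx_eq0.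
Qed.

Lemma mem0_eigenvalues w : (0 < n)%N -> 0 \in eigenvalues w.
Proof.
move=> n0; apply/mem_spectrumP; exists (\col_i 1).
  apply/eqP => /matrixP/(_ (Ordinal n0) 0) /eqP.
  by rewrite !mxE oner_eq0.
rewrite laplace_mxE scale0r; apply/matrixP => i j; rewrite !mxE /laplace.
case: ifP => // di; under eq_bigr do rewrite mulr1.
rewrite -rmorph_sum /= mulVf ?subrr //.
by rewrite (inj_eq (@complexI _)).
Qed.

(* For an undirected graph taking real parts of eigenvalues loses nothing. *)
Lemma undirected_eigenvalues_real w z :
  (forall i j, 0 <= w i j) -> w^T = w -> z \in eigenvalues w ->
  z = (complex.Re z)%:C.
Proof.
move=> w0 wsym /mem_spectrumP[v v0 /matrixP vE].
pose d i := (indeg w i)%:C.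
have d0 i : 0 <= d i by rewrite lecR sumr_ge0.
have conjR (x : R) : (x%:C)^*%R = x%:C by apply: conj_Creal; rewrite complex_real.
have vE' i : laplace w (v^~ 0) i = z * v i 0.
  have := vE i 0; rewrite [in RHS]mxE => <-.
  have -> : v = \col_i v i 0 by apply/matrixP => k l; rewrite mxE (ord1 l).
  rewrite laplace_mxE !mxE /laplace; case: ifP => // _; congr (_ - _ * _).
    by rewrite mxE.
  by apply: eq_bigr => k _; rewrite mxE.
pose S := \sum_i d i * `|v i 0| ^+ 2.
pose Q := \sum_i \sum_j (w i j)%:C * (v j 0 * (v i 0)^*%R).
have zS : z * S = S - Q.
  rewrite /S /Q mulr_sumr -sumrB; apply: eq_bigr => i _.
  have [di|di] := eqVneq (indeg w i) 0.
    rewrite /d di mul0r mulr0 big1 ?subr0 // => j _.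
    have /psumr_eq0P/(_ di j isT) -> : forall j, true -> 0 <= w i j by [].
    by rewrite mul0r.
  rewrite normCK mulrCA (mulrA z) -vE' /laplace di -/(d i).
  rewrite mulrBl mulrBr -!mulrA; congr (_ - _).
  rewrite mulVKf ?(inj_eq (@complexI _)) // mulr_suml.
  by apply: eq_bigr => j _; rewrite mulrA.
have SR : S^*%R = S.
  rewrite /S rmorph_sum; apply: eq_bigr => i _ /=.
  by rewrite rmorphM rmorphXn /= conj_normC conjR.
have QR : Q^*%R = Q.
  rewrite /Q rmorph_sum exchange_big /=; apply: eq_bigr => i _.
  rewrite rmorph_sum; apply: eq_bigr => j _ /=.
  by rewrite !rmorphM /= conjCK conjR -{1}wsym mxE (mulrC (_^*)%R).
have SJ : z * S = z^*%R * S.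
  have : (z * S)^*%R = z * S by rewrite zS rmorphB /= SR QR.
  by rewrite rmorphM /= SR => ->.
suff zR : z^*%R = z by rewrite RRe_real //; apply/CrealP.
have [S0|S0] := eqVneq S 0; last by have := mulIf S0 SJ.
have [i vi0] : exists i, v i 0 != 0.
  apply/existsP; apply: contraNT v0 => /existsPn v0.
  by apply/eqP/matrixP => i j; rewrite mxE (ord1 j); apply/eqP/negPn/v0.
have pos k : true -> 0 <= d k * `|v k 0| ^+ 2 by rewrite mulr_ge0 ?exprn_ge0.
have := psumr_eq0P pos S0 isT => /(_ i) /eqP.
rewrite mulf_eq0 expf_eq0 normr_eq0 (negbTE vi0) andbF orbF => /eqP[di].
have := vE' i; rewrite /laplace di eqxx /= => /esym /eqP.
by rewrite mulf_eq0 (negbTE vi0) orbF => /eqP ->; rewrite rmorph0.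
Qed.
End SpectrumTheory.

(* Main.v *)
Require Import Defs.
From mathcomp Require Import all_boot all_order all_algebra.
From mathcomp Require Import reals ring.
Import Order.TTheory GRing.Theory Num.Theory.
Local Open Scope ring_scope.

(** Put [p i j = w i j / indeg w i]. As there are at least two vertices, strong
    connectivity makes every in-degree positive, so the Laplacian of the graph
    is [L = 1 - p], and the Perron equation says exactly that [phi] is a left
    null vector of [L]. In the inner product weighted by [phi] the adjoint of
    [L] has entries [p j i * phi j / phi i] in place of [p i j]. Since the
    degrees of the symmetrized graph are [2 * phi i], its Laplacian is the
    self-adjoint part of [L], the mean of [L] and its adjoint.

    To work with the standard inner product, [L] is conjugated by the diagonal
    matrix of the [sqrt (phi i)]. This gives a matrix [S] similar to [L] whose
    Hermitian part is similar to the Laplacian of the symmetrized graph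
    ([hermitian_part_symmetrize_laplace]). The upper bound is then Bendixson's
    inequality ([bendixson]): the real part of an eigenvalue is a Rayleigh
    quotient of the Hermitian part, hence lies between two of its eigenvalues.

    For the lower bound the eigenvalue of the constant function has to be
    discarded on both sides. The vector [s] of the [sqrt (phi i)] is both a left
    and a right null vector of [S], so in an orthonormal basis that starts with
    a multiple of [s] the matrix [S] becomes block diagonal, with blocks [0] and
    [D], and its Hermitian part has the blocks [0] and [hermitian_part D]
    ([exists_deflation]). Deleting one root [0] from either characteristic
    polynomial therefore leaves that of [D], respectively of its Hermitian part,
    and Bendixson's inequality applies to [D]. *)

(** * Hermitian parts and Bendixson's inequality *)

Lemma char_poly_conjmx {F : fieldType} {n : nat} (P A : 'M[F]_n) :
  P \in unitmx -> char_poly (P *m A *m invmx P) = char_poly A.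
Proof.
move=> Pu; rewrite /char_poly /char_poly_mx.
have XE : 'X%:M = map_mx polyC P *m 'X%:M *m map_mx polyC (invmx P).
  by rewrite -mulmxA -scalar_mxC mulmxA -map_mxM mulmxV // map_mx1 mul1mx.
rewrite [in LHS]XE !map_mxM -mulmxBl -mulmxBr !det_mulmx mulrAC -det_mulmx -map_mxM.
by rewrite mulmxV // map_mx1 det1 mul1r.
Qed.

Section HermitianPart.
Local Open Scope sesquilinear_scope.
Context {C : numClosedFieldType}.

Definition hermitian_part {n : nat} (A : 'M[C]_n) : 'M[C]_n :=
  2^-1 *: (A + A^t* ).

Lemma hermitian_partE {n : nat} (A : 'M[C]_n) i j :
  hermitian_part A i j = 2^-1 * (A i j + (A j i)^*).
Proof. by rewrite !mxE. Qed.

Lemma hermitian_part_hermsym {n : nat} (A : 'M[C]_n) :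
  hermitian_part A \is hermsymmx.
Proof.
rewrite is_hermitianmxE expr0 scale1r; apply/eqP/matrixP => i j.
by rewrite !mxE rmorphM rmorphD /= conjCK fmorphV rmorph_nat addrC.
Qed.

Lemma hermitian_part_congr {n : nat} (T A : 'M[C]_n) :
  hermitian_part (T *m A *m T^t* ) = T *m hermitian_part A *m T^t*.
Proof.
rewrite /hermitian_part !trmx_mul !map_mxM !map_trmx trmxK.
rewrite -map_mx_comp (map_mx_id (@conjCK _)) -!map_trmx.
by rewrite -scalemxAr -scalemxAl mulmxDr mulmxDl !mulmxA.
Qed.

Lemma char_poly_conj_unitary {n : nat} {T : 'M[C]_n} (A : 'M[C]_n) :
  T \is unitarymx -> char_poly (T *m A *m T^t* ) = char_poly A.
Proof.
by move=> Tu; rewrite -invmx_unitary // char_poly_conjmx // unitarymx_unit.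
Qed.

(** A weighted mean of reals is at least the smallest of them; the mean in
    question is normalized to [0]. The codomain is only partially ordered,
    which is why the [c i] have to be assumed real. *)
Lemma exists_le0_of_weighted_sum_eq0 {I : finType} {c m : I -> C} :
    (forall i, c i \is Num.real) -> (forall i, 0 <= m i) ->
    (exists i, m i != 0) -> \sum_i c i * m i = 0 ->
  exists i, c i <= 0.
Proof.
move=> cR m0 [k mk] s0; apply/existsP; apply: contraNT mk => /existsPn c0.
have cp i : 0 < c i by rewrite real_ltNge ?rpred0.
have /psumr_eq0P : forall i, true -> 0 <= c i * m i.
  by move=> i _; rewrite mulr_ge0 // ltW.
move/(_ s0 k isT) => /eqP.
by rewrite mulf_eq0 (gt_eqF (cp k)).
Qed.

(** A row eigenvector [v] for [z] satisfies
    [v H v^* = 'Re z * v v^*] with [H] the Hermitian part. Expanding [v] in an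
    orthonormal eigenbasis of [H] turns this into: ['Re z] is the mean of the
    eigenvalues of [H] with weights the squared moduli of the coordinates. *)
Lemma bendixson {n : nat} (A : 'M[C]_n) (z : C) :
  root (char_poly A) z ->
  exists a b, [/\ root (char_poly (hermitian_part A)) a,
                  root (char_poly (hermitian_part A)) b & a <= 'Re z <= b].
Proof.
rewrite -eigenvalue_root_char => /eigenvalueP[v vA v0].
set H := hermitian_part A; set P := spectralmx H; set d := spectral_diag H.
have Pu : P \is unitarymx by exact: spectral_unitarymx.
have HE : H = P^t* *m diag_mx d *m P.
  have /hermitian_normalmx/orthomx_spectralP := hermitian_part_hermsym A.
  by rewrite invmx_unitary.
have dR i : d 0 i \is Num.real.
  by have /mxOverP := hermitian_spectral_diag_real (hermitian_part_hermsym A).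
have dH i : root (char_poly H) (d 0 i).
  rewrite HE -{2}(trmxCK P) char_poly_conj_unitary ?trmxC_unitary //.
  rewrite char_poly_trig ?diag_mx_is_trig // (bigD1 i) //=.
  by rewrite rootM mxE eqxx mulr1n root_XsubC eqxx.
(* The coordinates of v in the eigenbasis of H. *)
pose u := v *m P^t*.
have uP : u *m P = v by rewrite mulmxKtV.
have u0 : exists i, `|u 0 i| ^+ 2 != 0.
  apply/existsP; apply: contraNT v0 => /existsPn h.
  rewrite -uP (_ : u = 0) ?mul0mx //; apply/rowP => i; rewrite [RHS]mxE.
  by apply/eqP; have := h i; rewrite negbK expf_eq0 normr_eq0.
have Q : \sum_i (d 0 i - 'Re z) * `|u 0 i| ^+ 2 = 0.
  have vv : v *m v^t* = u *m u^t*.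
    by rewrite -[in LHS]uP trmx_mul map_mxM !mulmxA mulmxtVK.
  have vHv : v *m H *m v^t* = 'Re z *: (v *m v^t* ).
    rewrite /H /hermitian_part -scalemxAr -scalemxAl mulmxDr mulmxDl vA -scalemxAl.
    have -> : v *m A^t* *m v^t* = v *m (v *m A)^t*.
      by rewrite trmx_mul map_mxM mulmxA.
    rewrite vA linearZ /= map_mxZ -scalemxAr -scalerDl scalerA.
    by rewrite ReE mulrC.
  have : v *m H *m v^t* = u *m diag_mx d *m u^t*.
    by rewrite HE /u !mulmxA -!mulmxA trmx_mul map_mxM trmxCK.
  rewrite vHv vv => /matrixP/(_ 0 0); rewrite !mxE mulr_sumr => E.
  under eq_bigr => i _ do rewrite mulrBl.
  rewrite sumrB; apply/eqP; rewrite subr_eq0; apply/eqP.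
  transitivity (\sum_j (u *m diag_mx d) 0 j * (u^t* ) j 0).
    apply: eq_bigr => i _; rewrite mul_mx_diag !mxE normCK.
    by rewrite mulrCA mulrA.
  rewrite -E; apply: eq_bigr => i _; by rewrite !mxE normCK.
have m0 i : 0 <= `|u 0 i| ^+ 2 by rewrite exprn_ge0.
have rR i : d 0 i - 'Re z \is Num.real by rewrite rpredB // Creal_Re.
have [i di] := exists_le0_of_weighted_sum_eq0 rR m0 u0 Q.
have [||j dj] := exists_le0_of_weighted_sum_eq0 (c := fun i => - (d 0 i - 'Re z)) _ m0 u0.
- by move=> k; rewrite rpredN.
- by under eq_bigr do rewrite mulNr; rewrite sumrN Q oppr0.
exists (d 0 i), (d 0 j); split=> //.
by rewrite -subr_le0 di -subr_ge0 -oppr_le0.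
Qed.

(** * Splitting off a null vector *)

Lemma exists_unitary_row0 {m : nat} {s : 'rV[C]_m.+1} :
  s != 0 -> exists2 T : 'M[C]_m.+1, T \is unitarymx &
    exists2 c : C, c != 0 & row 0 T = c *: s.
Proof.
(* Gram-Schmidt orthonormalization returns an orthonormal basis even when the
   rows are dependent, and it keeps the line spanned by the first row; so all
   rows can be taken equal to s. *)
move=> s0; pose A : 'M[C]_m.+1 := \matrix_(i, j) s 0 j.
exists (schmidt A); first exact: schmidt_unitarymx.
have := row_schmidt_sub A 0; rewrite (bigD1 0) //= big1 ?addsmx0; last first.
  by move=> i /andP[i0 /eqP[]]; apply/val_inj/eqP; rewrite -(leqn0 i).
rewrite genmxE => /sub_rVP[a].
have -> : row 0 A = s by apply/rowP => j; rewrite !mxE.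
move=> sE; have a0 : a != 0 by apply: contraNneq s0 => a0; rewrite sE a0 scale0r.
by exists a^-1; rewrite ?invr_eq0 // sE scalerA mulVf // scale1r.
Qed.

Lemma block_mx_row0_col0 {m : nat} (B : 'M[C]_(1 + m)) :
  row 0 B = 0 -> col 0 B = 0 -> B = block_mx 0 0 0 (drsubmx B).
Proof.
move=> /rowP r0 /colP c0; rewrite -[LHS]submxK.
have lsh (k : 'I_1) : lshift m k = 0 by rewrite (ord1 k); apply/val_inj.
congr block_mx; apply/matrixP => i j; rewrite !mxE lsh.
- by have := r0 (lshift m j); rewrite !mxE.
- by have := r0 (rshift 1 j); rewrite !mxE.
- by have := c0 (rshift 1 i); rewrite !mxE.
Qed.

(** A common left and right null vector splits off as an orthogonal direct
    summand. The splitting comes from a unitary matrix, and therefore the same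
    [D] serves [S] and its Hermitian part. *)
Lemma exists_deflation {m : nat} {S : 'M[C]_m.+1} {s : 'rV[C]_m.+1} :
  s != 0 -> s *m S = 0 -> S *m s^t* = 0 ->
  exists D : 'M[C]_m,
    char_poly S = 'X * char_poly D /\
    char_poly (hermitian_part S) = 'X * char_poly (hermitian_part D).
Proof.
move=> s0 sS Ss; have [T Tu [c c0 Tc]] := exists_unitary_row0 s0.
pose B : 'M_(1 + m) := T *m S *m T^t*; pose D := drsubmx B.
have BE : B = block_mx 0 0 0 D.
  apply: block_mx_row0_col0.
    by rewrite /B !row_mul Tc -scalemxAl sS scaler0 mul0mx.
  rewrite /B colE -!mulmxA -colE.
  have -> : col 0 (T^t* ) = (row 0 T)^t* by apply/colP => i; rewrite !mxE.
  by rewrite Tc linearZ /= map_mxZ -scalemxAr Ss scaler0 mulmx0.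
have HE : hermitian_part B = block_mx 0 0 0 (hermitian_part D).
  rewrite /hermitian_part BE tr_block_mx map_block_mx add_block_mx.
  by rewrite scale_block_mx !trmx0 !map_mx0 !addr0 !scaler0.
have block (E : 'M[C]_m) : char_poly (block_mx 0 0 0 E : 'M_(1 + m)) = 'X * char_poly E.
  rewrite /char_poly char_block_diag_mx det_ublock; congr (_ * _).
  by rewrite det_mx11 !mxE eqxx subr0.
exists D; split.
  by rewrite -(char_poly_conj_unitary _ Tu) -[T *m S *m _]/B BE block.
rewrite -(char_poly_conj_unitary _ Tu) -hermitian_part_congr.
by rewrite -[T *m S *m _]/B HE block.
Qed.
End HermitianPart.

(** * Spectra as root multisets *)

Section Spectrum.
Context {R : realType} {n : nat}.
Local Open Scope complex_scope.

Lemma mem_spectrum (A : 'M[R[i]]_n) (z : R[i]) :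
  (z \in spectrum A) = root (char_poly A) z.
Proof. by rewrite prod_spectrum root_prod_XsubC. Qed.

Lemma mem_rem0_spectrum {A : 'M[R[i]]_n} {q : {poly R[i]}} (z : R[i]) :
  char_poly A = 'X * q -> (z \in rem 0 (spectrum A)) = root q z.
Proof.
move=> Aq; have A0 : 0 \in spectrum A by rewrite mem_spectrum Aq rootM rootX eqxx.
suff -> : q = \prod_(x <- rem 0 (spectrum A)) ('X - x%:P).
  by rewrite root_prod_XsubC.
apply: (mulfI (negbT (polyX_eq0 _))).
by rewrite -Aq prod_spectrum (perm_big _ (perm_to_rem A0)) big_cons subr0.
Qed.
End Spectrum.

(** * The symmetrized Laplacian *)

Section Symmetrization.
Context {R : realType} {n : nat}.
Implicit Types (w : 'M[R]_n) (phi : 'I_n -> R).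
Local Open Scope sesquilinear_scope.
Local Open Scope complex_scope.

Lemma strongly_connected_indeg_gt0 {w} :
  (2 <= n)%N -> (forall i j, 0 <= w i j) -> strongly_connected w ->
  forall i, 0 < indeg w i.
Proof.
move=> n2 w0 wc i; have [j ij] : exists j : 'I_n, i != j.
  apply/existsP; apply: contraTT n2 => /existsPn h.
  rewrite -leqNgt -[X in (X <= _)%N]card_ord -(cards1 i) -cardsT subset_leq_card //.
  by apply/subsetP => j _; rewrite inE eq_sym; have := h j; rewrite negbK.
have [_ /connectP[p]] := wc _ _ ij.
case: (lastP p) => [_ /eqP|q k]; first by rewrite (negbTE ij).
rewrite rcons_path last_rcons => /andP[_ +] ik; rewrite -ik /edge => wx.
by rewrite /indeg (bigD1 (last j q)) //= ltr_wpDr ?sumr_ge0 // lt_def wx w0.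
Qed.

Definition sqrt_diag phi : 'M[R[i]]_n := diag_mx (\row_i (Num.sqrt (phi i))%:C).

Lemma sqrt_diag_unit {phi} : (forall i, 0 < phi i) -> sqrt_diag phi \in unitmx.
Proof.
move=> p0; rewrite unitmxE det_diag unitfE; apply/prodf_neq0 => i _.
by rewrite mxE fmorph_eq0 gt_eqF // sqrtr_gt0.
Qed.

(** Conjugation by [sqrt_diag phi] is an isometry from the inner product
    weighted by [phi] to the standard one, so the Hermitian part of
    [symmetrize phi A] is the self-adjoint part of [A] for the weighted product. *)
Definition symmetrize phi (A : 'M[R[i]]_n) : 'M[R[i]]_n :=
  sqrt_diag phi *m A *m invmx (sqrt_diag phi).

Lemma symmetrizeE {phi} A i j : (forall i, 0 < phi i) ->
  symmetrize phi A i j = (Num.sqrt (phi i))%:C * A i j / (Num.sqrt (phi j))%:C.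
Proof.
move=> p0; have := mulmxKV (sqrt_diag_unit p0) (sqrt_diag phi *m A).
rewrite -/(symmetrize phi A) mul_mx_diag mul_diag_mx => /matrixP/(_ i j).
rewrite !mxE => <-; rewrite mulfK // fmorph_eq0 gt_eqF // sqrtr_gt0 //.
Qed.

Lemma char_poly_symmetrize {phi} A : (forall i, 0 < phi i) ->
  char_poly (symmetrize phi A) = char_poly A.
Proof. by move=> p0; rewrite char_poly_conjmx // sqrt_diag_unit. Qed.

Lemma laplace_mx_entry {w} i j : 0 < indeg w i ->
  laplace_mx w i j = ((i == j)%:R - w i j / indeg w i)%:C.
Proof.
move=> di; rewrite mxE /laplace gt_eqF //=.
rewrite (bigD1 j) //= eqxx mulr1 big1 ?addr0 => [|k kj]; last first.
  by rewrite (negbTE kj) mulr0.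
by rewrite rmorphB rmorphM fmorphV rmorph_nat /= mulrC.
Qed.

(** The first half of each degree is [phi i] because [w i j / indeg w i] sums to
    [1] over [j], and the second half is [phi i] by the Perron equation. *)
Lemma indeg_tilde_graph {w phi} : (forall i, 0 < indeg w i) ->
  is_perron w phi -> forall i, indeg (tilde_graph w phi) i = 2 * phi i.
Proof.
move=> d0 [_ pE] i; rewrite /indeg; under eq_bigr do rewrite mxE.
rewrite big_split /= pE -!mulr_suml mulfV ?gt_eqF ?d0 //.
by rewrite mul1r mulr_natl mulr2n.
Qed.

(** This identifies the symmetrized graph: up to similarity, its Laplacian is
    the Hermitian part of that of the directed graph. *)
Lemma hermitian_part_symmetrize_laplace {w phi} :
    (forall i, 0 < indeg w i) -> is_perron w phi ->
  hermitian_part (symmetrize phi (laplace_mx w)) =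
  symmetrize phi (laplace_mx (tilde_graph w phi)).
Proof.
move=> d0 wphi; have [p0 pE] := wphi; apply/matrixP => i j.
have dt := indeg_tilde_graph d0 wphi.
have conjR (x : R) : (x%:C)^*%R = x%:C by apply: conj_Creal; rewrite complex_real.
rewrite hermitian_partE !symmetrizeE // !laplace_mx_entry ?dt ?mulr_gt0 //.
rewrite -!(fmorphV (real_complex R)) -!(rmorphM (real_complex R)) /= conjR.
have -> : 2^-1 = (2^-1 : R)%:C :> R[i] by rewrite fmorphV rmorph_nat.
rewrite -rmorphD -rmorphM /=; congr (_%:C); rewrite mxE.
have r0 k : Num.sqrt (phi k) != 0 by rewrite gt_eqF // sqrtr_gt0.
have rE k : phi k = Num.sqrt (phi k) ^+ 2 by rewrite sqr_sqrtr // ltW.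
rewrite (eq_sym j i).
have di := lt0r_neq0 (d0 i); have dj := lt0r_neq0 (d0 j).
have [<-|_] := eqVneq i j.
  move: (r0 i) (rE i); move: (Num.sqrt (phi i)) => r r0i ->.
  by field; rewrite r0i di.
move: (r0 i) (rE i) (r0 j) (rE j).
move: (Num.sqrt (phi i)) (Num.sqrt (phi j)) => r s r0i -> s0j ->.
by rewrite /= mulr0n; field; rewrite r0i s0j di dj.
Qed.

Definition sqrt_row phi : 'rV[R[i]]_n := \row_i (Num.sqrt (phi i))%:C.

(** The Perron equation transported by the symmetrization. *)
Lemma sqrt_row_symmetrize {w phi} :
    (forall i, 0 < indeg w i) -> is_perron w phi ->
  sqrt_row phi *m symmetrize phi (laplace_mx w) = 0.
Proof.
move=> d0 [p0 pE]; apply/rowP => j; rewrite !mxE.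
under eq_bigr => i _.
  rewrite symmetrizeE // laplace_mx_entry // mxE !mulrA -rmorphM /= -expr2.
  rewrite sqr_sqrtr ?ltW // -rmorphM /= mulrBr (mulrC (phi i) (w i j / _)).
  over.
rewrite -mulr_suml -rmorph_sum sumrB pE /= (bigD1 j) //= eqxx mulr1.
rewrite big1 ?addr0 ?subrr ?rmorph0 ?mul0r // => i ij.
by rewrite (negbTE ij) mulr0.
Qed.

(** The constant function, a right null vector of the Laplacian, is transported
    to the same vector as [phi], a left one. *)
Lemma symmetrize_sqrt_row {w phi} :
    (forall i, 0 < indeg w i) -> (forall i, 0 < phi i) ->
  symmetrize phi (laplace_mx w) *m (sqrt_row phi)^t* = 0.
Proof.
move=> d0 p0; have conjR (x : R) : (x%:C)^*%R = x%:C.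
  by apply: conj_Creal; rewrite complex_real.
have r0 j : (Num.sqrt (phi j))%:C != 0.
  by rewrite fmorph_eq0 gt_eqF // sqrtr_gt0.
apply/colP => i; rewrite !mxE.
under eq_bigr => j _.
  rewrite symmetrizeE // laplace_mx_entry // !mxE conjR mulfVK //.
  over.
rewrite -mulr_sumr -rmorph_sum sumrB -mulr_suml (mulfV (lt0r_neq0 (d0 i))) (bigD1 i) //=.
rewrite eqxx big1 ?addr0 ?subrr ?rmorph0 ?mulr0 // => j ji.
by rewrite eq_sym (negbTE ji).
Qed.

End Symmetrization.

(** * Extrema of sequences and the eigenvalue bounds *)

Section Extrema.
Context {R : realType}.

Lemma min_seq_le {s : seq R} {x : R} : x \in s -> min_seq s <= x.
Proof.
rewrite /min_seq; elim: s (head 0 s) => // y s IH x0.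
rewrite inE big_cons ge_min => /predU1P[->|/IH ->]; last exact: orbT.
by rewrite lexx.
Qed.

Lemma max_seq_ge {s : seq R} {x : R} : x \in s -> x <= max_seq s.
Proof.
rewrite /max_seq; elim: s (head 0 s) => // y s IH x0.
rewrite inE big_cons le_max => /predU1P[->|/IH ->]; last exact: orbT.
by rewrite lexx.
Qed.

Lemma le_min_seq {s : seq R} {x : R} :
  s != [::] -> {in s, forall y, x <= y} -> x <= min_seq s.
Proof.
case: s => // y s _ xs; rewrite /min_seq big_seq le_bigmin // xs //.
exact: mem_head.
Qed.

Lemma max_seq_le {s : seq R} {x : R} :
  s != [::] -> {in s, forall y, y <= x} -> max_seq s <= x.
Proof.
case: s => // y s _ xs; rewrite /max_seq big_seq bigmax_le // xs //.
exact: mem_head.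
Qed.

End Extrema.

(** Over [R[i]] the order compares real parts of numbers with equal imaginary
    parts, which turns the bounds into bounds in [R]. *)
Lemma bendixson_Re {R : realType} {n : nat} {A : 'M[R[i]]_n} {z : R[i]} :
  root (char_poly A) z ->
  exists a b, [/\ root (char_poly (hermitian_part A)) a,
                  root (char_poly (hermitian_part A)) b &
                  complex.Re a <= complex.Re z <= complex.Re b].
Proof.
move=> /bendixson[a [b [Ha Hb /andP[az zb]]]]; exists a, b; split=> //.
by apply/andP; split; move: az zb; rewrite -complexRe !lecE /= => /andP[_ +] /andP[_ +].
Qed.

Theorem theorem8p3 (R : realType) (n : nat) (w : 'M[R]_n) (phi : 'I_n -> R)
    (hn : (2 <= n)%N)
    (hw : forall i j : 'I_n, 0 <= w i j)
    (hconn : strongly_connected w)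
    (hphi : is_perron w phi) :
  let wt := tilde_graph w phi in
  [/\ min_seq [seq complex.Re z | z <- nonzeroth_eigenvalues wt]
        <= min_seq [seq complex.Re z | z <- nonzeroth_eigenvalues w],
      min_seq [seq complex.Re z | z <- nonzeroth_eigenvalues w]
        <= max_seq [seq complex.Re z | z <- eigenvalues w]
    & max_seq [seq complex.Re z | z <- eigenvalues w]
        <= max_seq [seq complex.Re z | z <- eigenvalues wt]].
Proof.
case: n => [//|m] in w phi hn hw hconn hphi *.
move=> wt; have d0 := strongly_connected_indeg_gt0 hn hw hconn.
have [p0 _] := hphi; set S := symmetrize phi (laplace_mx w).
have S_w : char_poly S = char_poly (laplace_mx w) by exact: char_poly_symmetrize.
have S_wt : char_poly (hermitian_part S) = char_poly (laplace_mx wt).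
  by rewrite hermitian_part_symmetrize_laplace // char_poly_symmetrize.
have size_nz : size (nonzeroth_eigenvalues w) = m.
  by rewrite size_rem ?mem0_eigenvalues ?size_spectrum.
have nz_neq0 : [seq complex.Re z | z <- nonzeroth_eigenvalues w] != [::].
  by rewrite -size_eq0 size_map size_nz -lt0n.
split.
- have s0 : sqrt_row phi != 0.
    apply/eqP => /rowP/(_ 0)/eqP; rewrite !mxE fmorph_eq0 gt_eqF //.
    by rewrite sqrtr_gt0.
  have [D [SD hSD]] := exists_deflation s0 (sqrt_row_symmetrize d0 hphi)
    (symmetrize_sqrt_row d0 p0).
  apply: le_min_seq => // _ /mapP[z + ->].
  rewrite (mem_rem0_spectrum _ (etrans (esym S_w) SD)) => /bendixson_Re.
  move=> [a [_ [Da _ /andP[az _]]]]; apply: le_trans az.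
  apply/min_seq_le/map_f.
  by rewrite (mem_rem0_spectrum _ (etrans (esym S_wt) hSD)).
- move: size_nz nz_neq0 (@mem_rem _ 0 (eigenvalues w)).
  rewrite -/(nonzeroth_eigenvalues w).
  case: (nonzeroth_eigenvalues w) => // z s _ _ sub.
  apply: (le_trans (min_seq_le (mem_head _ _))).
  by apply/max_seq_ge/map_f/sub/mem_head.
- apply: max_seq_le.
    by rewrite -size_eq0 size_map size_spectrum.
  move=> _ /mapP[z + ->]; rewrite mem_spectrum -S_w => /bendixson_Re.
  move=> [_ [b [_ Hb /andP[_ zb]]]]; apply: le_trans zb _.
  by apply/max_seq_ge/map_f; rewrite mem_spectrum -S_wt.
Qed.
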